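(* Let $\mathcal{D}$ be a dataset of points in $\mathbb{R}^d$, let $\epsilon>0$, $R>0$, $W>0$ be integers (with $\epsilon$ real), and let $\mathcal{F}$ be any locality-sensitive hash family of functions $\mathbb{R}^d\to\{1,\dots,W\}$. Construct the private RACE sketch $\mathcal{S}_{\mathcal{D}}\in\mathbb{Z}^{R\times W}$ as follows: draw $R$ independent functions $l_1,\dots,l_R$ from $\mathcal{F}$; initialize $\mathcal{S}_{\mathcal{D}}=0$; for each $\mathbf{x}\in\mathcal{D}$ and each $r=1,\dots,R$, increment $\mathcal{S}_{\mathcal{D}}[r,l_r(\mathbf{x})]$ by one; finally set $\mathcal{S}_{\mathcal{D}}=\lfloor \mathcal{S}_{\mathcal{D}}+Z\rfloor$ (entrywise floor), where $Z\in\mathbb{R}^{R\times W}$ has i.i.d. entries distributed as $\mathrm{Lap}(R/\epsilon)$ independent of everything else. Then the output $\mathcal{S}_{\mathcal{D}}$ is $\epsilon$-differentially private.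
   Context: A randomized function $\mathcal{A}$ provides $\epsilon$-differential privacy if for all neighboring databases $\mathcal{D},\mathcal{D}'$ (databases which differ in at most one element) and all subsets $S$ of the codomain of $\mathcal{A}$, $\Pr[\mathcal{A}(\mathcal{D})\in S]\le e^{\epsilon}\Pr[\mathcal{A}(\mathcal{D}')\in S]$. $\mathrm{Lap}(b)$ denotes the zero-mean Laplace distribution with scale $b$. A hash family $\mathcal{F}$ is locality-sensitive with collision probability $k(\cdot,\cdot)$ if for any $\mathbf{x},\mathbf{y}$, $l(\mathbf{x})=l(\mathbf{y})$ with probability $k(\mathbf{x},\mathbf{y})$ when $l$ is drawn uniformly at random from $\mathcal{F}$. *)

(* Defs.v *)
From HB Require Import structures.
From mathcomp Require Import all_boot all_order all_algebra.
From mathcomp Require Import all_classical all_reals all_analysis.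

Set Implicit Arguments.
Unset Strict Implicit.
Unset Printing Implicit Defensive.

Import Order.TTheory GRing.Theory Num.Theory.
Import numFieldNormedType.Exports.

Local Open Scope classical_set_scope.
Local Open Scope ring_scope.

Section probability_notions.
Context (R : realType) (d : measure_display) (T : measurableType d)
  (P : probability T R).

Definition mutually_independent (I : finType) (E : I -> set_system T) : Prop :=
  forall (J : {set I}) (A : I -> set T),
    (forall i, i \in J -> E i (A i)) ->
    P (\bigcap_(i in [set` J]) A i) = (\prod_(i in J) P (A i))%E.

Definition sigma_of (d' : measure_display) (T' : measurableType d')
    (X : T -> T') : set_system T :=
  preimage_set_system setT X measurable.

(* A randomized function on databases is given by its coins: its output on the
   input D is the random element A D of Y. *)
Definition differentially_private (DB Y : Type) (neighbors : DB -> DB -> Prop)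
    (eps : R) (A : DB -> T -> Y) : Prop :=
  forall D D', neighbors D D' ->
  forall S : set Y,
    (P (A D @^-1` S) <= (expR eps)%:E * P (A D' @^-1` S))%E.

End probability_notions.

Definition laplace_pdf (R : realType) (b x : R) : R :=
  (2 * b)^-1 * expR (- (`|x| / b)).

Definition laplace_prob (R : realType) (b : R) (B : set R) : \bar R :=
  (\int[lebesgue_measure]_(x in B) (laplace_pdf b x)%:E)%E.

(* Databases are finite multisets, encoded as sequences up to permutation. Two
   databases differ in at most one element when one is obtained from the other
   by adding or removing at most one element. Replacing an element is two such
   steps: it can change two counters in every row of the sketch. *)
Definition neighboring (X : eqType) (D D' : seq X) : Prop :=
  perm_eq D D' \/ exists x, perm_eq D (x :: D') \/ perm_eq D' (x :: D).

(* A hash family is indexed by a probability space (F, mu), the element l of F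
   standing for the function hash l, and mu for the law of a random draw from
   the family; the uniform law on a finite family is a special case. Measurability
   of the evaluations makes the hash value of a point a random variable. *)
Definition locality_sensitive (R : realType) (X : Type) (W : nat)
    (d : measure_display) (F : measurableType d) (mu : probability F R)
    (hash : F -> X -> 'I_W) (k : X -> X -> R) : Prop :=
  (forall (x : X) (w : 'I_W), measurable [set l | hash l x = w]) /\
  (forall x y : X, mu [set l | hash l x = hash l y] = (k x y)%:E).

Definition race_sketch (X : Type) (m W : nat) (l : 'I_m -> X -> 'I_W)
    (D : seq X) : 'M[int]_(m, W) :=
  foldl (fun S x => S + \matrix_(r, w) (l r x == w)%:R) 0 D.

Definition private_race_sketch (R : realType) (X : Type) (m W : nat)
    (l : 'I_m -> X -> 'I_W) (Z : 'M[R]_(m, W)) (D : seq X) : 'M[int]_(m, W) :=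
  \matrix_(r, w) Num.floor ((race_sketch l D r w)%:~R + Z r w).

(* Main.v *)
Require Import Defs.
From HB Require Import structures.
From mathcomp Require Import all_boot all_order all_algebra.
From mathcomp Require Import all_classical all_reals all_analysis.
From mathcomp Require Import measurable_realfun.

Import Order.TTheory GRing.Theory Num.Theory.
Import numFieldNormedType.Exports.

Local Open Scope classical_set_scope.
Local Open Scope ring_scope.

(* Reveal, besides the sketch, the hash values of all the points of the larger of
   the two databases. Given these, the entries of the sketch are independent, and
   the two databases give counts that differ in one entry per row, by one.
   Translating Lap(m / eps) by one changes probabilities by a factor of at most
   exp (eps / m), so each of the m rows contributes that factor, exp eps in all.
   The enlarged output lives in a countable type, so it is enough to compare
   point probabilities, and the hash values can then be forgotten. *)

(** * Comparing outputs in a countable type, and products of probabilities *)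

Lemma le_probability_countable {R : realType} {d : measure_display}
    {T : measurableType d} (P : probability T R) {Y : countType} (c : R)
    (A A' : T -> Y) :
  0 <= c ->
  (forall y, measurable (A @^-1` [set y])) ->
  (forall y, measurable (A' @^-1` [set y])) ->
  (forall y, P (A @^-1` [set y]) <= c%:E * P (A' @^-1` [set y]))%E ->
  forall S : set Y, (P (A @^-1` S) <= c%:E * P (A' @^-1` S))%E.
Proof.
move=> c0 mA mA' AA' S.
(* The preimage of [S] is cut into pieces numbered by the codes of the points of [S]. Each piece is
   the fibre of one point, the same for every [B], or is empty for every [B]; countable additivity
   leaves a termwise comparison of series. *)
pose piece (B : T -> Y) i := B @^-1` [set y | S y /\ pickle y = i].
have pieceE i : (exists y, forall B : T -> Y, piece B i = B @^-1` [set y]) \/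
    forall B : T -> Y, piece B i = set0.
  have [[y [Sy yi]]|no] := pselect (exists y, S y /\ pickle y = i).
    left; exists y => B; rewrite /piece; apply/seteqP; split => t /=;
      last by move=> ->.
    by move=> [_ Bti]; apply: (pcan_inj pickleK); rewrite Bti yi.
  by right => B; rewrite -subset0 => t Bt; apply: no; exists (B t).
have sumE (B : T -> Y) : (forall y, measurable (B @^-1` [set y])) ->
    P (B @^-1` S) = (\sum_(0 <= i <oo) P (piece B i))%E.
  move=> mB; have mpiece i : measurable (piece B i).
    by have [[y ->]|->] := pieceE i.
  rewrite -measure_semi_bigcup//.
  - congr (P _); apply/seteqP; split => [t St|t [i _ []]//].
    by exists (pickle (B t)).
  - apply/trivIsetP => i j _ _ /eqP ij; rewrite -subset0.
    by move=> t [[_ Bi] [_ Bj]]; apply: ij; rewrite -Bi.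
  - exact: bigcup_measurable.
rewrite !sumE// -nneseriesZl//; apply: lee_nneseries => // i _.
by have [[y yE]|i0] := pieceE i; rewrite ?yE// !i0 measure0 mule0.
Qed.

Lemma lee_prod {R : realDomainType} {I : Type} (s : seq I) (p : pred I)
    (f g : I -> \bar R) :
  (forall i, p i -> 0 <= f i <= g i)%E ->
  (\prod_(i <- s | p i) f i <= \prod_(i <- s | p i) g i)%E.
Proof.
(* Nonnegativity of the smaller product is carried through the induction, since multiplying the
   inequalities needs it. *)
move=> fg; suff /andP[] : (0 <= \prod_(i <- s | p i) f i <=
    \prod_(i <- s | p i) g i)%E by [].
elim/big_ind2 : _ => [|x1 x2 y1 y2 /andP[x0 x12] /andP[y0 y12]|//].
  by rewrite lexx lee01.
by rewrite mule_ge0//= lee_pmul.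
Qed.

(** * The Laplace law under translation *)

Lemma laplace_pdf_ge0 {R : realType} (b x : R) : 0 < b -> 0 <= laplace_pdf b x.
Proof. by move=> b0; rewrite mulr_ge0 ?expR_ge0// invr_ge0 mulr_ge0// ltW. Qed.

(** By the triangle inequality [|x| <= |x + h| + |h|], the exponent grows by at most [|h| / b]. *)
Lemma laplace_pdf_shift_le {R : realType} (b h x : R) : 0 < b ->
  laplace_pdf b (x + h) <= expR (`|h| / b) * laplace_pdf b x.
Proof.
move=> b0; rewrite /laplace_pdf mulrCA ler_wpM2l//.
  by rewrite invr_ge0 mulr_ge0// ltW.
rewrite -expRD ler_expR -mulNr -mulNr -mulrDl ler_wpM2r ?invr_ge0 ?(ltW b0)//.
rewrite lerNl opprB lerBlDr.
by rewrite -[in leLHS](addrK h x) (le_trans (ler_normB _ _))// addrC.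
Qed.

Lemma continuous_laplace_pdf {R : realType} (b : R) :
  continuous (laplace_pdf b).
Proof.
move=> x; apply: cvgMr.
apply: (@continuous_comp _ _ _ (fun x => - (`|x| / b)) expR).
  by apply: cvgN; apply: cvgMl; exact: norm_continuous.
exact: continuous_expR.
Qed.

Lemma integral_shift {R : realType} (f : R -> R) (a b h : R) : a <= b ->
  continuous f ->
  (\int[lebesgue_measure]_(x in `[(a + h)%R, (b + h)%R]) (f x)%:E =
   \int[lebesgue_measure]_(x in `[a, b]) (f (x + h)%R)%:E)%E.
Proof.
move=> ab cf.
have dh : derive1 (shift h : R -> R) = cst 1.
  by apply/funext => x; rewrite derive1E; have [_ ->] := is_derive_shift x 1 h.
have ch : continuous (shift h : R -> R).
  by move=> x; apply: cvgD; [exact: cvg_id|exact: cvg_cst].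
rewrite (integration_by_substitution_increasing (F := shift h))//.
- by apply: eq_integral => x _; rewrite /= fctE dh mulr1.
- by move=> x y _ _ xy; rewrite /shift ltrD2r.
- by rewrite dh => ? ?; exact: cvg_cst.
- by rewrite dh; exact: is_cvg_cst.
- by rewrite dh; exact: is_cvg_cst.
- split.
  + by move=> x _; have [] := is_derive_shift x 1 h.
  + exact/cvg_at_right_filter/ch.
  + exact/cvg_at_left_filter/ch.
- exact: continuous_subspaceT.
Qed.

Lemma laplace_prob_shift_le {R : realType} (b h u v : R) : 0 < b -> u <= v ->
  (laplace_prob b `[(u + h)%R, (v + h)%R[ <=
   (expR (`|h| / b))%:E * laplace_prob b `[u, v[)%E.
Proof.
move=> b0 uv; rewrite /laplace_prob.
have mpdf D : measurable_fun D (laplace_pdf b).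
  apply: measurable_funTS; apply: continuous_measurable_fun.
  exact: continuous_laplace_pdf.
have mpdfE D : measurable_fun D (EFin \o laplace_pdf b).
  exact/measurable_EFinP.
(* An endpoint is Lebesgue-null; closing the intervals gives the form that [integral_shift]
   handles. *)
rewrite !integral_itv_bndo_bndc//.
rewrite integral_shift//; last exact: continuous_laplace_pdf.
rewrite -ge0_integralZl_EFin//=; last 2 first.
- by move=> x _; rewrite lee_fin laplace_pdf_ge0.
- exact: mpdfE.
apply: ge0_le_integral => //=.
- by move=> x _; rewrite lee_fin laplace_pdf_ge0.
- apply/measurable_EFinP; apply: (measurableT_comp (mpdf setT)).
  by apply: measurable_funD.
- by apply: measurable_funeM; exact: mpdfE.
- by move=> x _; rewrite -EFinM lee_fin laplace_pdf_shift_le.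
Qed.

Lemma floor_addl_preimage {R : realType} (c n : int) :
  [set z : R | Num.floor (c%:~R + z) = n] =
  `[(n - c)%:~R, (n - c)%:~R + 1[%classic.
Proof.
apply/seteqP; split => z /=; rewrite in_itv/= intrB lerBlDl.
  by move=> <-; have := floor_itv (c%:~R + z); rewrite intrD addrAC ltrBrDl.
rewrite addrAC ltrBrDl => zn; apply/eqP.
by rewrite floor_eq intrD.
Qed.

Lemma laplace_prob_floor_le {R : realType} (b : R) (c c' n : int) : 0 < b ->
  (laplace_prob b [set z | Num.floor (c%:~R + z)%R = n] <=
   (expR (`|c - c'|%:~R / b))%:E *
   laplace_prob b [set z | Num.floor (c'%:~R + z)%R = n])%E.
Proof.
move=> b0; rewrite !floor_addl_preimage.
(* The unit interval for [c] is the one for [c'] translated by [c' - c]. *)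
have -> : (n - c)%:~R = (n - c')%:~R + (c' - c)%:~R :> R.
  by rewrite -intrD addrA subrK.
rewrite (addrAC _ (c' - c)%:~R) distrC intr_norm laplace_prob_shift_le//.
by rewrite lerDl.
Qed.

(** * Counters of the sketch and hash values *)

Lemma race_sketchE {X : Type} {m W : nat} (l : 'I_m -> X -> 'I_W) (D : seq X)
    (r : 'I_m) (w : 'I_W) :
  race_sketch l D r w = (count_mem w (map (l r) D))%:Z.
Proof.
rewrite /race_sketch -[RHS]add0r.
(* [foldl] changes its initial matrix at each step, so zero is read as an entry of that matrix,
   which the induction generalizes. *)
have -> : 0 = (0 : 'M[int]_(m, W)) r w by rewrite mxE.
elim: D 0 => [S|x D IH S] /=; first by rewrite addr0.
by rewrite IH !mxE PoszD addrA; case: eqP.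
Qed.

Lemma race_sketch_perm {X : eqType} {m W : nat} (l : 'I_m -> X -> 'I_W)
    (D D' : seq X) : perm_eq D D' -> race_sketch l D = race_sketch l D'.
Proof.
move=> DD'; apply/matrixP => r w; rewrite !race_sketchE.
by congr Posz; apply/permP/perm_map.
Qed.

Lemma measurable_hash_values {X : Type} {W : nat} {d : measure_display}
    {F : measurableType d} (hash : F -> X -> 'I_W) :
  (forall x w, measurable [set l | hash l x = w]) ->
  forall (xs : seq X) s, measurable [set l | map (hash l) xs = s].
Proof.
move=> mh; elim=> [|x xs IH] [|w s] /=.
- by rewrite (_ : mkset _ = setT)//; apply/seteqP; split.
- by rewrite (_ : mkset _ = set0)//; apply/seteqP; split.
- by rewrite (_ : mkset _ = set0)//; apply/seteqP; split.
- rewrite (_ : mkset _ = [set l | hash l x = w] `&`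
    [set l | map (hash l) xs = s]); first exact: measurableI.
  by apply/seteqP; split => l /= [-> ->].
Qed.

(** * Privacy of the noisy counts *)

Section noisy_counts.
Context {R : realType} {X : Type} {m W : nat} {eps : R}.
Context {dF : measure_display} {F : measurableType dF}.
Context {hash : F -> X -> 'I_W}.
Context {dT : measure_display} {T : measurableType dT} {P : probability T R}.
Context {L : 'I_m -> {RV P >-> F}} {Z : 'I_m -> 'I_W -> {RV P >-> R}}.
Hypothesis eps_gt0 : 0 < eps.
Hypothesis m_gt0 : (0 < m)%N.
Hypothesis mhash : forall x w, measurable [set l | hash l x = w].
Hypothesis lawZ : forall (r : 'I_m) (w : 'I_W) (B : set R), measurable B ->
  distribution P (Z r w) B = laplace_prob (m%:R / eps) B.
Hypothesis indepLZ : mutually_independent P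
  (fun i : ('I_m + 'I_m * 'I_W)%type =>
     match i with
     | inl r => sigma_of (L r)
     | inr rw => sigma_of (Z rw.1 rw.2)
     end).

Definition hash_table (xs : seq X) (t : T) : {ffun 'I_m -> seq 'I_W} :=
  [ffun r => map (hash (L r t)) xs].

(** The map [g] lets one revealed list [xs] serve both neighbors: [id] counts all of [xs], [behead]
    leaves out its first point, and the hash table is the same for both. *)
Definition noisy_counts (g : seq 'I_W -> seq 'I_W) (xs : seq X) (t : T) :
    'M[int]_(m, W) :=
  \matrix_(r, w) Num.floor ((count_mem w (g (hash_table xs t r)))%:~R + Z r w t).

(** One event per independent source. The noise events count with the fixed [tau] instead of the
    random hash table, so each depends on a single noise variable; the hash events force the two
    tables to agree. *)
Let cell (g : seq 'I_W -> seq 'I_W) (xs : seq X) (M : 'M[int]_(m, W))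
    (tau : {ffun 'I_m -> seq 'I_W}) (i : 'I_m + 'I_m * 'I_W) : set T :=
  match i with
  | inl r => L r @^-1` [set l | map (hash l) xs = tau r]
  | inr rw => Z rw.1 rw.2 @^-1` [set z |
      Num.floor ((count_mem rw.2 (g (tau rw.1)))%:~R + z) = M rw.1 rw.2]
  end.

Let measurable_floor_preimage (c n : int) :
  measurable [set z : R | Num.floor (c%:~R + z) = n].
Proof. by rewrite floor_addl_preimage. Qed.

Let measurable_cell g xs M tau i : measurable (cell g xs M tau i).
Proof.
case: i => [r|rw] /=; apply: measurable_funPTI => //.
exact: measurable_hash_values.
Qed.

Let preimage_cell g xs M tau :
  (fun t => (noisy_counts g xs t, hash_table xs t)) @^-1` [set (M, tau)] =
  \bigcap_(i in [set` [set: 'I_m + 'I_m * 'I_W]%SET]) cell g xs M tau i.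
Proof.
apply/seteqP; split => t /=.
  by move=> [<- <-] [r|[r w]] _ /=; rewrite ?mxE ?ffunE.
move=> tcell; have tauE : hash_table xs t = tau.
  apply/ffunP => r; rewrite ffunE.
  by have := tcell (inl r); rewrite /= inE; exact.
congr pair => //; apply/matrixP => r w; rewrite mxE tauE.
by have := tcell (inr (r, w)); rewrite /= inE; exact.
Qed.

Let probability_cell g xs M tau :
  P (\bigcap_(i in [set` [set: 'I_m + 'I_m * 'I_W]%SET]) cell g xs M tau i) =
  (\prod_i P (cell g xs M tau i))%E.
Proof.
rewrite indepLZ; first by apply: eq_bigl => i; rewrite inE.
move=> [r|rw] _ /=.
- exists [set l | map (hash l) xs = tau r]; last by rewrite setTI.
  exact: measurable_hash_values.
- eexists; last by rewrite setTI.
  exact: measurable_floor_preimage.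
Qed.

Lemma noisy_counts_private (g g' : seq 'I_W -> seq 'I_W) (xs : seq X) :
  (forall s, \sum_(w < W)
     `|(count_mem w (g s))%:Z - (count_mem w (g' s))%:Z| <= 1) ->
  forall S : set 'M[int]_(m, W),
  (P (noisy_counts g xs @^-1` S) <=
   (expR eps)%:E * P (noisy_counts g' xs @^-1` S))%E.
Proof.
move=> gg' S.
pose out h t := (noisy_counts h xs t, hash_table xs t).
have mout h y : measurable (out h @^-1` [set y]).
  case: y => M tau; rewrite /out preimage_cell.
  exact: fin_bigcap_measurable.
(* Pulling [S] back along the first projection forgets the hash values. *)
apply: (le_probability_countable P (expR eps) (out g) (out g') (expR_ge0 _)
  (mout g) (mout g') _ [set y | S y.1]).
move=> [M tau]; rewrite /out !preimage_cell !probability_cell.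
(* [diff i / b] is the exponent lost at source [i]; it is 0 for a hash event, which does not involve
   [g]. *)
pose diff (i : 'I_m + 'I_m * 'I_W) : int := match i with
  | inl _ => 0
  | inr rw => `|(count_mem rw.2 (g (tau rw.1)))%:Z -
                (count_mem rw.2 (g' (tau rw.1)))%:Z|
  end.
pose b : R := m%:R / eps.
have b_gt0 : 0 < b by rewrite divr_gt0// ltr0n.
apply: (@le_trans _ _
  (\prod_i ((expR ((diff i)%:~R / b))%:E * P (cell g' xs M tau i)))%E).
  apply: lee_prod => -[r|rw] _; rewrite measure_ge0/=.
    by rewrite mul0r expR0 mul1e.
  have := laplace_prob_floor_le b (count_mem rw.2 (g (tau rw.1)))
    (count_mem rw.2 (g' (tau rw.1))) (M rw.1 rw.2) b_gt0.
  by rewrite /b -!(lawZ rw.1 rw.2).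
rewrite big_split/= prodEFin lee_wpmul2r//.
  by apply: prode_ge0 => i _.
(* Since [eps * b = m], it remains to bound the sum of the differences by [m], that is, by one per
   row. *)
rewrite lee_fin -expR_sum ler_expR -mulr_suml ler_pdivrMr//.
rewrite /b mulrC divfK ?gt_eqF// -rmorph_sum/= pmulrn ler_int.
rewrite big_sumType/= big1// add0r.
rewrite -(pair_bigA _ (fun r w => `|(count_mem w (g (tau r)))%:Z -
  (count_mem w (g' (tau r)))%:Z|))/=.
rewrite (le_trans (ler_sum _ (fun r _ => gg' (tau r))))//.
by rewrite sumr_const card_ord -natz.
Qed.

End noisy_counts.

(** Removing the head [v] lowers only the counter of [v], by one; the empty list is unchanged. *)
Lemma sum_count_mem_behead {W : nat} (s : seq 'I_W) :
  \sum_(w < W) `|(count_mem w s)%:Z - (count_mem w (behead s))%:Z| <= 1.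
Proof.
case: s => [|v s] /=; first by rewrite big1.
under eq_bigr do rewrite PoszD addrK.
by rewrite (bigD1 v)//= eqxx big1 ?addr0// => w /negPf; rewrite eq_sym => ->.
Qed.

Theorem theorem3 (R : realType) (d m W : nat) (eps : R)
    (heps : 0 < eps) (hm : (0 < m)%N) (hW : (0 < W)%N)
    (dF : measure_display) (F : measurableType dF) (mu : probability F R)
    (hash : F -> 'rV[R]_d -> 'I_W) (k : 'rV[R]_d -> 'rV[R]_d -> R)
    (hF : locality_sensitive mu hash k)
    (dT : measure_display) (T : measurableType dT) (P : probability T R)
    (L : 'I_m -> {RV P >-> F}) (Z : 'I_m -> 'I_W -> {RV P >-> R})
    (hL : forall (r : 'I_m) (B : set F), measurable B ->
       distribution P (L r) B = mu B)
    (hZ : forall (r : 'I_m) (w : 'I_W) (B : set R), measurable B ->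
       distribution P (Z r w) B = laplace_prob (m%:R / eps) B)
    (hLZ : mutually_independent P
       (fun i : ('I_m + 'I_m * 'I_W)%type =>
          match i with
          | inl r => sigma_of (L r)
          | inr rw => sigma_of (Z rw.1 rw.2)
          end)) :
  differentially_private P (@neighboring 'rV[R]_d) eps
    (fun D t => private_race_sketch
       (fun r => hash (L r t)) (\matrix_(r, w) Z r w t) D).
Proof.
case: hF => mhash _ D D' DD' S.
pose A D t := private_race_sketch
  (fun r => hash (L r t)) (\matrix_(r, w) Z r w t) D.
have permA D1 D2 : perm_eq D1 D2 -> A D1 = A D2.
  move=> D12; apply/funext => t; apply/matrixP => r w.
  by rewrite !mxE (race_sketch_perm _ D1 D2).
(* The relation is asked of every [f] because each row applies its own random hash function. *)
have AE g (xs ys : seq 'rV[R]_d) :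
    (forall f : 'rV[R]_d -> 'I_W, map f ys = g (map f xs)) ->
    A ys = @noisy_counts R _ m W _ F hash _ T P L Z g xs.
  move=> gE; apply/funext => t; apply/matrixP => r w.
  by rewrite !mxE race_sketchE gE ffunE.
have private := noisy_counts_private heps hm mhash hZ hLZ.
rewrite -/(A D) -/(A D').
case: DD' => [/permA->|[x [/permA->|/permA->]]].
(* Both outputs coincide, and [expR eps >= 1]. *)
- rewrite lee_pemull// lee_fin.
  by rewrite -expR0 ler_expR ltW.
- rewrite (AE id (x :: D') (x :: D'))// (AE behead (x :: D') D')//.
  by apply: private => s; exact: sum_count_mem_behead.
(* Now [D'] is the larger database, so [id] and [behead] exchange roles; the row distance is
   symmetric. *)
- rewrite (AE id (x :: D) (x :: D))// (AE behead (x :: D) D)//.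
  apply: private => s; under eq_bigr do rewrite distrC.
  exact: sum_count_mem_behead.
Qed.
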